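(* Let $\varepsilon\in(0,1)$ and $\alpha\ge 1$. There is a one-pass streaming algorithm which, given two general turnstile streams on $[n]$ with frequency vectors $f,g\in\mathbb{R}^n$, both satisfying the $L_1$ $\alpha$-property, with probability at least $11/13$ outputs an estimate $\mathtt{IP}(f,g)$ satisfying $$\mathtt{IP}(f,g)=\langle f,g\rangle \pm O(\varepsilon)\,\|f\|_1\|g\|_1,$$ and uses $O\!\left(\varepsilon^{-1}\log\!\left(\frac{\alpha\log n}{\varepsilon}\right)\right)$ bits of space.
   Context: A data stream on universe $[n]$ is a sequence of $m$ updates $(i_t,\Delta_t)\in[n]\times\{-M,\dots,M\}$; the frequency vector $f\in\mathbb{R}^n$ starts at $0$ and update $(i_t,\Delta_t)$ adds $\Delta_t$ to $f_{i_t}$. It is assumed that $\log(mM)=O(\log n)$. In the general turnstile model the updates $\Delta_t$ may be arbitrary (positive or negative). The insertion vector $I$ is the frequency vector of the substream of updates with $\Delta_t\ge 0$, and the deletion vector $D$ is the entrywise absolute value of the frequency vector of the substream of updates with $\Delta_t<0$, so $f=I-D$. The stream has the $L_1$ $\alpha$-property ($\alpha\ge1$) if $\|I+D\|_1\le\alpha\|f\|_1$. $\langle f,g\rangle=\sum_i f_ig_i$. Space is measured in bits. *)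

(* Defs.v *)
From mathcomp Require Import all_boot all_order all_algebra.
From mathcomp Require Import reals exp.
Set Implicit Arguments. Unset Strict Implicit. Unset Printing Implicit Defensive.
Import Order.TTheory GRing.Theory Num.Theory.
Local Open Scope ring_scope.

Definition log2 {R : realType} (x : R) : R := ln x / ln 2.

(* A tagged update: (which stream (false = f, true = g), index i, value Delta). *)
Definition tupdate (n : nat) := (bool * 'I_n * int)%type.

Definition substream (n : nat) (b : bool) (s : seq (tupdate n)) : seq ('I_n * int) :=
  [seq (u.1.2, u.2) | u <- s & u.1.1 == b].

Definition freq (n : nat) (s : seq ('I_n * int)) (i : 'I_n) : int :=
  \sum_(u <- s | u.1 == i) u.2.
Definition insv (n : nat) (s : seq ('I_n * int)) (i : 'I_n) : int :=
  \sum_(u <- s | (u.1 == i) && (0 <= u.2)) u.2.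
Definition delv (n : nat) (s : seq ('I_n * int)) (i : 'I_n) : int :=
  `| \sum_(u <- s | (u.1 == i) && (u.2 < 0)) u.2 |.

Definition l1norm (n : nat) (v : 'I_n -> int) : int := \sum_i `|v i|.

Definition inner (n : nat) (f g : 'I_n -> int) : int := \sum_i f i * g i.

Definition alpha_property {R : realType} (n : nat) (alpha : R)
  (s : seq ('I_n * int)) : Prop :=
  (l1norm (fun i => insv s i + delv s i))%:~R <= alpha * (l1norm (freq s))%:~R.

(* A one-pass randomized streaming algorithm on universe [n] using S bits of
   memory: its memory state is one of 2^S states.  It draws a uniform coin in
   'I_K to pick its initial state and a fresh independent uniform coin in 'I_K
   at each update (randomness that must be reused has to be stored in the
   state).  At the end it outputs a real number computed from its state. *)
Record stream_alg (n S : nat) (R : realType) := StreamAlg {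
  sa_K : nat;
  sa_init : 'I_sa_K -> 'I_(2 ^ S);
  sa_step : 'I_(2 ^ S) -> tupdate n -> 'I_sa_K -> 'I_(2 ^ S);
  sa_out : 'I_(2 ^ S) -> R }.

Fixpoint sa_exec (n S : nat) (R : realType) (A : stream_alg n S R)
  (st : 'I_(2 ^ S)) (s : seq (tupdate n)) (c : nat -> 'I_(sa_K A)) (k : nat)
  : 'I_(2 ^ S) :=
  match s with
  | [::] => st
  | u :: s' => @sa_exec n S R A (@sa_step _ _ _ A st u (c k)) s' c k.+1
  end.

(* final memory state given the coin sequence c (c 0 = initial coin,
   c (k+1) = coin used when processing the k-th update) *)
Definition sa_final (n S : nat) (R : realType) (A : stream_alg n S R)
  (s : seq (tupdate n)) (c : {ffun 'I_(size s).+1 -> 'I_(sa_K A)}) : 'I_(2 ^ S) :=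
  @sa_exec _ _ _ A (@sa_init _ _ _ A (c ord0)) s (fun k => c (inord k.+1)) 0.

Definition sa_prob (n S : nat) (R : realType) (A : stream_alg n S R)
  (s : seq (tupdate n)) (P : R -> bool) : R :=
  (#|[set c : {ffun 'I_(size s).+1 -> 'I_(sa_K A)} |
        P (@sa_out _ _ _ A (@sa_final _ _ _ A s c))]|)%:R / ((sa_K A) ^ (size s).+1)%:R.

(* Main.v *)
Require Import Defs.
From mathcomp Require Import all_boot all_order all_algebra all_field.
From mathcomp Require Import reals exp.
From mathcomp Require Import zify ring lra.
Import Order.TTheory GRing.Theory Num.Theory.
Local Open Scope ring_scope.
Set Implicit Arguments. Unset Strict Implicit. Unset Printing Implicit Defensive.

(* Hash the coordinates into k = O(1/eps) buckets. Only pairwise collision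
   probabilities matter, and a Reed-Solomon codeword symbol followed by a random
   affine map makes them O(1/k) with a seed of O(log (log n / eps)) bits; the
   inner product of the bucketed vectors then differs from <f,g> by
   O(eps) |f|_1 |g|_1 in expectation. For each stream, bucket and sign of the
   update keep the accumulated absolute value in an approximate counter: a value
   on a nearly geometric grid of ratio 1 + O((eps/alpha)^2), randomly rounded
   without bias after each update, which takes O(log (alpha log n / eps)) bits.
   Its expected error is at most eps/alpha times the true count, so the errors of
   all the counters of f add up to (eps/alpha) |I + D|_1 <= eps |f|_1. Three
   applications of Markov's inequality conclude. *)

(** * Averages over finite probability spaces *)

Definition avg (R : realFieldType) (T : finType) (f : T -> R) : R :=
  (\sum_t f t) / #|T|%:R.

Section Average.
Variables (R : realFieldType) (T : finType).
Implicit Types f g : T -> R.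

Lemma eq_avg f g : f =1 g -> avg f = avg g.
Proof. by move=> fg; rewrite /avg (eq_bigr g). Qed.

Lemma ler_avg f g : (forall t, f t <= g t) -> avg f <= avg g.
Proof. by move=> fg; rewrite ler_wpM2r ?invr_ge0 ?ler0n// ler_sum. Qed.

Lemma avgD f g : avg (fun t => f t + g t) = avg f + avg g.
Proof. by rewrite /avg big_split mulrDl. Qed.

Lemma avgZ a f : avg (fun t => a * f t) = a * avg f.
Proof. by rewrite /avg -mulr_sumr mulrA. Qed.

Lemma avg_sum (I : finType) (F : I -> T -> R) :
  avg (fun t => \sum_i F i t) = \sum_i avg (F i).
Proof. by rewrite /avg exchange_big mulr_suml. Qed.

Lemma avg_cst (a : R) : (0 < #|T|)%N -> avg (fun _ : T => a) = a.
Proof.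
by move=> T0; rewrite /avg sumr_const -(mulr_natr a) mulfK// pnatr_eq0 -lt0n.
Qed.

Lemma avg_ge0 f : (forall t, 0 <= f t) -> 0 <= avg f.
Proof. by move=> f0; rewrite mulr_ge0 ?invr_ge0 ?ler0n ?sumr_ge0. Qed.

(** Only an upper bound [mu] on the mean is at hand, and [mu] may be zero: then [f] vanishes
    identically and the strict event is empty. *)
Lemma markov f (mu t : R) : (forall x, 0 <= f x) -> 0 < t -> avg f <= mu ->
  avg (fun x => (t * mu < f x)%R%:R) <= t^-1.
Proof.
move=> f0 t0 fmu; have mu0 := le_trans (avg_ge0 f0) fmu.
case: (ltrP 0 mu) => [mup|mule].
  have le x : (t * mu < f x)%R%:R <= (t * mu)^-1 * f x.
    case: ltP => [h|_]; last by rewrite mulr_ge0 ?invr_ge0 ?mulr_ge0 ?(ltW t0).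
    by rewrite mulrC ler_pdivlMr ?mulr_gt0// mul1r ltW.
  apply: le_trans (ler_avg le) _.
  rewrite avgZ invfM -mulrA ler_piMr ?invr_ge0 ?(ltW t0)//.
  by rewrite mulrC ler_pdivrMr// mul1r.
have mue : mu = 0 by apply/eqP; rewrite eq_le mule.
have avg0 : avg f = 0 by apply/eqP; rewrite eq_le avg_ge0// -mue fmu.
rewrite (@eq_avg _ (fun=> 0)) => [|x].
  by rewrite /avg big1// mul0r invr_ge0 ltW.
rewrite mue mulr0; move/eqP: avg0; rewrite mulf_eq0 => /orP[|].
  by rewrite psumr_eq0// => /allP/(_ x); rewrite mem_index_enum => /(_ isT)/eqP->;
    rewrite ltxx.
rewrite invr_eq0 pnatr_eq0 => /eqP c0.
by have := fintype0 x c0.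
Qed.

End Average.

Lemma reindex_avg (R : realFieldType) (T U : finType) (h : U -> T) (f : T -> R) :
  bijective h -> avg f = avg (fun u => f (h u)).
Proof.
move=> bh; rewrite /avg (reindex h) ?(bij_eq_card bh)//.
by case: bh => g gh hg; exists g => x _.
Qed.

Lemma avg_pair (R : realFieldType) (T U : finType) (f : T * U -> R) :
  avg f = avg (fun t => avg (fun u => f (t, u))).
Proof.
rewrite /avg card_prod natrM invfM mulrCA mulrC -mulr_suml; congr (_ * _ * _).
by rewrite pair_bigA; apply: eq_bigr => -[].
Qed.

(** Reduction modulo a divisor of [K] keeps a coin uniform, so one coin range serves both the choice
    of the seed and every rounding probability. *)
Lemma avg_modn (R : realFieldType) (K g : nat) (G : nat -> R) :
  (0 < K)%N -> (g %| K)%N ->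
  avg (fun c : 'I_K => G (c %% g)%N) = (\sum_(i < g) G i) / g%:R.
Proof.
move=> K0 /dvdnP[t Kt]; rewrite /avg card_ord.
have [t0 g0] : (0 < t)%N /\ (0 < g)%N by move: K0; rewrite Kt muln_gt0 => /andP.
rewrite -(big_mkord xpredT (fun i => G (i %% g)%N)) Kt big_nat_mul.
rewrite (eq_big_nat _ _ (F2 := fun=> \sum_(i < g) G i)) => [|i _].
  rewrite big_mkord sumr_const card_ord -(mulr_natr (\sum_(_ < _) _)) natrM invfM.
  rewrite [t%:R^-1 * _]mulrC mulrA mulrAC mulfK// pnatr_eq0 -lt0n //.
rewrite -{1}[(i * g)%N]add0n big_addn mulSn addnK big_mkord.
by apply: eq_bigr => j _; rewrite addnC modnMDl modn_small.
Qed.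

Lemma avg_round (R : realFieldType) (K g r : nat) (x y : R) :
  (0 < K)%N -> (g %| K)%N -> (r <= g)%N ->
  avg (fun c : 'I_K => if (c %% g < r)%N then x else y) =
  y + r%:R / g%:R * (x - y).
Proof.
move=> K0 gK rg; rewrite (avg_modn (fun i => if (i < r)%N then x else y))//.
have g0 : (0 < g)%N by apply: dvdn_gt0 gK.
have gn0 : g%:R != 0 :> R by rewrite pnatr_eq0 -lt0n.
have -> : \sum_(i < g) (if (i < r)%N then x else y) = r%:R * (x - y) + g%:R * y.
  rewrite -(big_mkord xpredT (fun i => if (i < r)%N then x else y)).
  rewrite (big_cat_nat _ (n := r))//=.
  rewrite (eq_big_nat _ _ (F2 := fun=> x)) => [|i /andP[_ ->]//].
  rewrite (eq_big_nat _ _ (m := r) (F2 := fun=> y)) => [|i /andP[]]; last first.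
    by rewrite leqNgt => /negbTE ->.
  by rewrite !sumr_const_nat subn0 -(mulr_natr x) -(mulr_natr y) natrB//; ring.
by field.
Qed.

Lemma avg_modn_enum (R : realFieldType) (T : finType) (x0 : T) (K : nat)
    (f : T -> R) : (0 < K)%N -> (#|T| %| K)%N ->
  avg (fun c : 'I_K => f (nth x0 (enum T) (c %% #|T|)%N)) = avg f.
Proof.
move=> K0 TK; rewrite (avg_modn (fun i => f (nth x0 (enum T) i)))//.
congr (_ / _); rewrite -[RHS]big_enum (big_nth x0) -cardE.
by rewrite big_mkord.
Qed.

(** * A randomly rounded counter *)

(* Consecutive grid values differ by [1 + floor (a / B)]: the grid is exact below
   [B] and geometric with ratio about [1 + 1/B] above, so that about
   [B * log N] of them reach [N]. *)
Fixpoint grid (B v : nat) : nat :=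
  if v is v'.+1 then (grid B v' + (grid B v' %/ B).+1)%N else 0%N.

Lemma gridS B v : grid B v.+1 = (grid B v + (grid B v %/ B).+1)%N.
Proof. by []. Qed.

Lemma grid_lt B v w : (v < w)%N -> (grid B v < grid B w)%N.
Proof.
have lt1 u : (grid B u < grid B u.+1)%N by rewrite gridS addnS ltnS leq_addr.
by elim: w => // w IH; rewrite ltnS leq_eqVlt => /orP[/eqP->//|/IH/ltn_trans]; apply.
Qed.

Lemma grid_le B v w : (v <= w)%N -> (grid B v <= grid B w)%N.
Proof. by rewrite leq_eqVlt => /orP[/eqP->//|/(grid_lt B)/ltnW]. Qed.

(** Each of the [B] steps after [v] adds at least [(grid B v %/ B).+1], so together they add at
    least [grid B v]. *)
Lemma grid_double B v : (0 < B)%N -> (2 * grid B v <= grid B (v + B))%N.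
Proof.
move=> B0.
have lin t : (grid B v + t * (grid B v %/ B).+1 <= grid B (v + t))%N.
  elim: t => [|t IH]; first by rewrite mul0n !addn0.
  have /(leq_div2r B) := grid_le B (leq_addr t v).
  by rewrite addnS gridS; lia.
have := lin B; have := divn_eq (grid B v) B; have := ltn_pmod (grid B v) B0; nia.
Qed.

Lemma grid_exp B t : (0 < B)%N -> (2 ^ t <= grid B (t * B).+1)%N.
Proof.
move=> B0; elim: t => [|t IH]; first by rewrite mul0n /= div0n.
rewrite expnS [(t.+1 * B)%N]mulSn -addnS [(B + _)%N]addnC; apply: leq_trans (grid_double _ B0).
by rewrite leq_mul2l.
Qed.

Definition cell (B V y : nat) : nat :=
  find (fun j => y < grid B j.+1)%N (iota 0 V).

Lemma cellP B V y : (y < grid B V)%N ->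
  (cell B V y < V)%N /\ (grid B (cell B V y) <= y < grid B (cell B V y).+1)%N.
Proof.
move=> yV; set p := (fun j => y < grid B j.+1)%N.
have V0 : (0 < V)%N by case: V yV.
have hp : has p (iota 0 V).
  by apply/hasP; exists V.-1; rewrite ?mem_iota /p ?prednK//= add0n.
have cV : (cell B V y < V)%N by rewrite -[V in (_ < V)%N](size_iota 0) -has_find.
have := nth_find 0%N hp; rewrite -/(cell B V y) nth_iota// add0n /p => ->.
split=> //; rewrite andbT; case E: (cell B V y) => [//|j].
have jc : (j < cell B V y)%N by rewrite E.
have := before_find 0%N jc; rewrite nth_iota ?(ltn_trans jc)// add0n /p.
by move/negbT; rewrite -leqNgt.
Qed.

(* The rounding is unbiased. Clamping sums beyond the largest grid value only
   brings them closer to a true count that is itself below that value. *)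
Definition bump (B V v D c : nat) : 'I_V.+1 :=
  let y := (grid B v + D)%N in
  if (grid B V <= y)%N then ord_max else
  let j := cell B V y in
  if (c %% (grid B j %/ B).+1 < y - grid B j)%N then inord j.+1 else inord j.

Section Bump.
Variables (R : realFieldType) (B V K : nat).
Hypothesis B0 : (0 < B)%N.
Hypothesis K0 : (0 < K)%N.
Hypothesis gapK : forall j, (j < V)%N -> ((grid B j %/ B).+1 %| K)%N.

(** [A] is the grid value at or just below the sum, [g.+1] the gap above it and [r] the offset, so
    rounding up has probability [r / g.+1]. The bound [g * B <= A] controls the variance. *)
Lemma avg_bump (v D : nat) (F : nat -> R) : (grid B v + D < grid B V)%N ->
  exists A g r : nat, [/\ (grid B v <= A)%N, (A + r = grid B v + D)%N,
    (r < g.+1)%N, (g * B <= A)%N &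
    avg (fun c : 'I_K => F (grid B (bump B V v D c))) =
    F A + r%:R / g.+1%:R * (F (A + g.+1)%N - F A)].
Proof.
move=> yV; set y := (_ + _)%N in yV *; have [jV /andP[jy yj]] := cellP yV.
set j := cell B V y in jV jy yj; exists (grid B j), (grid B j %/ B)%N, (y - grid B j)%N.
split.
- apply: grid_le; rewrite -ltnS.
  by rewrite ltnNge; apply/negP => /(grid_le B); rewrite gridS in yj *; lia.
- lia.
- by move: yj; rewrite gridS; lia.
- exact: leq_trunc_div.
rewrite -[X in _ = X](@avg_round _ K) ?gapK//; last first.
  by move: yj; rewrite gridS; lia.
apply: eq_avg => c; rewrite /bump -/y leqNgt yV /= -/j.
by case: ifP => _; rewrite inordK// ltnS// ltnW.
Qed.

Lemma avg_bump_mean (v D : nat) :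
  avg (fun c : 'I_K => (grid B (bump B V v D c))%:R) <= (grid B v + D)%:R :> R.
Proof.
case: (ltnP (grid B v + D)%N (grid B V)) => [yV|Vy].
  have [A [g [r [_ yE rg _ ->]]]] := avg_bump (fun z => z%:R) yV.
  have : g.+1%:R != 0 :> R by rewrite pnatr_eq0.
  by rewrite -yE !natrD; move: (g.+1%:R : R) => G G0; rewrite le_eqVlt; apply/orP;
    left; apply/eqP; field.
rewrite (@eq_avg _ _ _ (fun=> (grid B V)%:R)) => [|c].
  by rewrite avg_cst ?card_ord// ler_nat.
by rewrite /bump Vy.
Qed.

(** Unbiased rounding adds exactly the variance [r * (g.+1 - r)]. Here [i] is the true count before
    the update. *)
Lemma avg_bump_sq (v D i : nat) : (i + D <= grid B V)%N ->
  avg (fun c : 'I_K => ((grid B (bump B V v D c))%:R - (i + D)%:R) ^+ 2) <=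
  ((grid B v)%:R - i%:R) ^+ 2 + D%:R * (grid B v + D)%:R / B%:R :> R.
Proof.
move=> tV; have BR : 0 < B%:R :> R by rewrite ltr0n.
case: (ltnP (grid B v + D)%N (grid B V)) => [yV|Vy].
  have [A [g [r [vA yE rg gB ->]]]] :=
    avg_bump (fun z => (z%:R - (i + D)%:R) ^+ 2) yV.
  have rD : (r <= D)%N by lia.
  have lhsE : (A%:R - (i + D)%:R) ^+ 2 + r%:R / g.+1%:R *
      (((A + g.+1)%:R - (i + D)%:R) ^+ 2 - (A%:R - (i + D)%:R) ^+ 2) =
      ((grid B v)%:R - i%:R) ^+ 2 + r%:R * (g.+1%:R - r%:R) :> R.
    have -> : (grid B v)%:R = A%:R + r%:R - D%:R :> R.
      by rewrite -natrD yE natrD addrK.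
    have : g.+1%:R != 0 :> R by rewrite pnatr_eq0.
    by rewrite !natrD; move: (g.+1%:R : R) => G G0; field.
  rewrite lhsE lerD2l ler_pdivlMr// -yE.
  rewrite -natrB ?(ltnW rg)// -!natrM ler_nat.
  (* No variance if [r = 0]; otherwise [r <= D] and [g.+1 - r <= g <= A / B]. *)
  case: r rg yE rD {lhsE} => [|r] rg yE rD; first by rewrite mul0n mul0n.
  rewrite -mulnA leq_mul// subSS.
  by apply: leq_trans (leq_trans gB (leq_addr _ _)); rewrite leq_mul2r leq_subr orbT.
rewrite (@eq_avg _ _ _ (fun=> ((grid B V)%:R - (i + D)%:R) ^+ 2)) => [|c]; last first.
  by rewrite /bump Vy.
rewrite avg_cst ?card_ord//.
have le1 : ((grid B V)%:R - (i + D)%:R) ^+ 2 <= ((grid B v)%:R - i%:R) ^+ 2 :> R.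
  have -> : (grid B v)%:R - i%:R = (grid B v + D)%:R - (i + D)%:R :> R.
    by rewrite !natrD; ring.
  by rewrite lerXn2r ?nnegrE ?subr_ge0 ?ler_nat ?(leq_trans tV)// lerD2r ler_nat.
by rewrite (le_trans le1)// lerDl divr_ge0 ?mulr_ge0 ?ler0n.
Qed.

End Bump.

(** * Expected final states *)

Fixpoint Ex (R : realFieldType) (T U : Type) (K : nat) (step : T -> U -> 'I_K -> T)
    (phi : T -> R) (s : seq U) (x : T) : R :=
  if s is u :: s' then avg (fun c => Ex step phi s' (step x u c)) else phi x.

Lemma Ex_sim (R : realFieldType) (T T' U : Type) (K : nat)
    (step : T -> U -> 'I_K -> T) (step' : T' -> U -> 'I_K -> T') (h : T' -> T)
    (phi : T -> R) (s : seq U) (x : T') :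
  (forall x u c, step (h x) u c = h (step' x u c)) ->
  Ex step phi s (h x) = Ex step' (fun y => phi (h y)) s x.
Proof.
move=> sim; elim: s x => //= u s IH x; apply: eq_avg => c.
by rewrite sim IH.
Qed.

(** The first component will be the hash seed, which no update changes, so it may be frozen at its
    initial value. *)
Lemma Ex_invariant (R : realFieldType) (S W U : Type) (K : nat)
    (step : S * W -> U -> 'I_K -> S * W) (phi : S * W -> R) (s : seq U) (x : S * W) :
  (forall x u c, (step x u c).1 = x.1) ->
  Ex step phi s x = Ex step (fun y => phi (x.1, y.2)) s x.
Proof.
move=> inv; elim: s x => [|u s IH] x /=; first by case: x.
by apply: eq_avg => c; rewrite IH inv.
Qed.

Lemma Ex_cst (R : realFieldType) (T U : Type) (K : nat)
    (step : T -> U -> 'I_K -> T) (a : R) (s : seq U) (x : T) :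
  (0 < K)%N -> Ex step (fun=> a) s x = a.
Proof.
move=> K0; elim: s x => //= u s IH x.
by rewrite (eq_avg (g := fun=> a)) ?avg_cst ?card_ord.
Qed.

Definition fcons (X : finType) (m : nat) (p : X * {ffun 'I_m -> X}) :
    {ffun 'I_m.+1 -> X} :=
  [ffun i => oapp p.2 p.1 (unlift ord0 i)].

Lemma fcons0 (X : finType) (m : nat) (p : X * {ffun 'I_m -> X}) :
  fcons p ord0 = p.1.
Proof. by rewrite ffunE unlift_none. Qed.

Lemma fcons_lift (X : finType) (m : nat) (p : X * {ffun 'I_m -> X}) i :
  fcons p (lift ord0 i) = p.2 i.
Proof. by rewrite ffunE liftK. Qed.

Lemma fcons_bij (X : finType) (m : nat) : bijective (@fcons X m).
Proof.
exists (fun f : {ffun 'I_m.+1 -> X} => (f ord0, [ffun i => f (lift ord0 i)])).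
  move=> [x c] /=; rewrite fcons0; congr pair.
  by apply/ffunP => i; rewrite ffunE fcons_lift.
move=> f; apply/ffunP => i; case: (unliftP ord0 i) => [j|] ->.
  by rewrite fcons_lift ffunE.
by rewrite fcons0.
Qed.

Lemma sa_exec_ext (n S : nat) (R : realType) (A : stream_alg n S R) s st c k c' k' :
  (forall i, (i < size s)%N -> c (k + i)%N = c' (k' + i)%N) ->
  @sa_exec n S R A st s c k = sa_exec st s c' k'.
Proof.
elim: s st k k' => //= u s IH st k k' cc'.
have := cc' 0%N (ltn0Sn _); rewrite !addn0 => ->.
by apply: IH => i si; rewrite !addSnnS; apply: cc'.
Qed.

(** Independence of the coins turns the average over coin sequences into iterated averages. [init]
    is arbitrary so that the induction can absorb the first update into it, the next coin then
    acting as the initial one. *)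
Lemma avg_sa_exec (n S : nat) (R : realType) (A : stream_alg n S R)
    (phi : 'I_(2 ^ S) -> R) (s : seq (tupdate n)) (init : 'I_(sa_K A) -> 'I_(2 ^ S)) :
  avg (fun c : {ffun 'I_(size s).+1 -> 'I_(sa_K A)} =>
         phi (sa_exec (init (c ord0)) s (fun k => c (inord k.+1)) 0)) =
  avg (fun x => Ex (@sa_step _ _ _ A) phi s (init x)).
Proof.
elim: s init => [|u s IH] init; rewrite (reindex_avg _ (@fcons_bij _ _)) avg_pair.
  apply: eq_avg => x /=.
  rewrite (eq_avg (g := fun=> phi (init x))) => [|c]; last by rewrite fcons0.
  by rewrite avg_cst// card_ffun !card_ord.
apply: eq_avg => x; rewrite /= -IH; apply: eq_avg => c.
have in1 k : (k <= size s)%N -> inord k.+1 = lift ord0 (inord k : 'I_(size s).+1)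
    :> 'I_(size s).+2.
  by move=> ks; apply: val_inj; rewrite /= /bump !inordK.
rewrite fcons0 in1// fcons_lift (_ : inord 0 = ord0); last first.
  by apply: val_inj; rewrite /= inordK.
congr phi; apply: sa_exec_ext => i si.
by rewrite !add1n add0n in1// fcons_lift.
Qed.

Lemma sa_probE (n S : nat) (R : realType) (A : stream_alg n S R) s (P : R -> bool) :
  sa_prob A s P = avg (fun c => (P (sa_out A (@sa_final _ _ _ A s c)))%:R).
Proof.
rewrite /sa_prob /avg card_ffun !card_ord; congr (_ / _).
rewrite -sum1_card natr_sum big_mkcond /=; apply: eq_bigr => c _.
by rewrite inE; case: (P _).
Qed.

(** * Error of the approximate counters along a stream *)

Section Counters.
Variables (R : realFieldType) (n k B V K : nat) (T : finType).
Variable h : T -> 'I_n -> 'I_k.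
Hypothesis B0 : (0 < B)%N.
Hypothesis K0 : (0 < K)%N.
Hypothesis gapK : forall j, (j < V)%N -> ((grid B j %/ B).+1 %| K)%N.

(** Insertions and deletions go to separate counters, so that true counts never decrease. *)
Definition slot (t : T) (u : tupdate n) : bool * 'I_k * bool :=
  (u.1.1, h t u.1.2, u.2 < 0).

Definition cstate := (T * {ffun bool * 'I_k * bool -> 'I_V.+1})%type.

Definition cstep (x : cstate) (u : tupdate n) (c : 'I_K) : cstate :=
  (x.1, [ffun j => if j == slot x.1 u then bump B V (x.2 j) `|u.2|%N c else x.2 j]).

Definition mass (t : T) (j : bool * 'I_k * bool) (s : seq (tupdate n)) : nat :=
  (\sum_(u <- s | slot t u == j) `|u.2|)%N.

(* [i] is the true count at the present state; generalizing over it lets the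
   variances of the successive roundings telescope. *)
Lemma Ex_counter_sq t j s w (i : nat) : (i + mass t j s <= grid B V)%N ->
  Ex cstep (fun x => ((grid B (x.2 j))%:R - (i + mass t j s)%:R) ^+ 2) s (t, w) <=
  ((grid B (w j))%:R - i%:R) ^+ 2 +
    (mass t j s)%:R * (grid B (w j) + mass t j s)%:R / B%:R :> R.
Proof.
have BR : 0 < B%:R :> R by rewrite ltr0n.
elim: s w i => [|u s IH] w i.
  by rewrite /mass !big_nil /= mul0r mul0r addr0 addn0.
rewrite /mass big_cons -/(mass t j s); set m := mass t j s.
set D := `|u.2|%N; case: ifP => uj le /=; last first.
  rewrite -[leRHS](@avg_cst R 'I_K) ?card_ord//; apply: ler_avg => c.
  by apply: le_trans (IH _ _ le) _; rewrite /= ffunE eq_sym uj.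
rewrite addnA in le *.
set x' := fun c => grid B (bump B V (w j) D c).
(* The inductive bound, split into a squared error and a part affine in the new counter value; the
   estimates for a single rounding apply to each. *)
pose ub (c : 'I_K) : R := ((x' c)%:R - (i + D)%:R) ^+ 2 +
  (m%:R / B%:R * (x' c)%:R + m%:R * m%:R / B%:R).
apply: (@le_trans _ _ (avg ub)).
  apply: ler_avg => c; apply: le_trans (IH _ _ le) _.
  by rewrite /= ffunE eq_sym uj -/(x' c) /ub natrD lerD2l le_eqVlt; apply/orP;
    left; apply/eqP; field; rewrite gt_eqF.
rewrite /ub !avgD avgZ avg_cst ?card_ord//.
have sq := avg_bump_sq R B0 K0 gapK (w j) (leq_trans (leq_addr _ _) le).
have mn := avg_bump_mean R B0 K0 gapK (w j) D.
apply: le_trans (lerD sq (lerD (ler_wpM2l _ mn) (lexx _))) _.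
  by rewrite divr_ge0 ?ler0n.
(* The slack left is exactly [D * m / B]. *)
rewrite -!addrA lerD2l -subr_ge0 !natrD.
have -> : (D%:R + m%:R) * ((grid B (w j))%:R + (D%:R + m%:R)) / B%:R -
    (D%:R * ((grid B (w j))%:R + D%:R) / B%:R +
     (m%:R / B%:R * ((grid B (w j))%:R + D%:R) + m%:R * m%:R / B%:R)) =
    D%:R * m%:R / B%:R :> R by field; rewrite gt_eqF.
by rewrite divr_ge0 ?mulr_ge0 ?ler0n.
Qed.

(* [|z| <= z ^+ 2] for integers settles the case of an empty counter; otherwise
   AM-GM: [2 beta m |z| <= beta ^+ 2 z ^+ 2 + m ^+ 2]. *)
Lemma Ex_counter_abs beta t j s (w : {ffun bool * 'I_k * bool -> 'I_V.+1}) :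
  B = (beta * beta)%N -> w j = ord0 ->
  (mass t j s <= grid B V)%N ->
  Ex cstep (fun x => `|(grid B (x.2 j))%:R - (mass t j s)%:R|) s (t, w) <=
  (mass t j s)%:R / beta%:R :> R.
Proof.
move=> BE w0 le; set m := mass t j s in le *.
have b0 : (0 < beta)%N by move: B0; rewrite BE muln_gt0 andbb.
have b0R : 0 < beta%:R :> R by rewrite ltr0n.
have sq := @Ex_counter_sq t j s w 0 le.
rewrite w0 /= subr0 expr0n /= !add0n add0r -/m in sq.
have Ex_le phi psi (s' : seq (tupdate n)) x : (forall y, phi y <= psi y) ->
    Ex cstep phi s' x <= Ex cstep psi s' x :> R.
  move=> pp; elim: s' x => //= u s' IH x; exact: ler_avg.
have ExZ a phi (s' : seq (tupdate n)) x :
    Ex cstep (fun y => a * phi y) s' x = a * Ex cstep phi s' x :> R.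
  by elim: s' x => //= u s' IH x; rewrite -avgZ; apply: eq_avg => c; rewrite IH.
have ExDc a phi (s' : seq (tupdate n)) x :
    Ex cstep (fun y => phi y + a) s' x = Ex cstep phi s' x + a :> R.
  elim: s' x => //= u s' IH x; rewrite -[X in _ + X](@avg_cst R 'I_K) ?card_ord//.
  by rewrite -avgD; apply: eq_avg => c; rewrite IH.
move: m le sq => [|m] le sq.
  rewrite mul0r. rewrite !mul0r in sq; refine (le_trans (Ex_le _ _ _ _ _) sq) => x.
  rewrite subr0 normr_nat -natrX ler_nat; case: (grid _ _) => // v.
  by rewrite expnS leq_pmulr// expn_gt0.
have : 0 < m.+1%:R :> R by rewrite ltr0n.
move: (m.+1%:R : R) sq => M sq M0.
have amgm (z : R) : `|z| <= beta%:R / (M + M) * z ^+ 2 + M / (beta%:R + beta%:R).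
  rewrite -[z ^+ 2]real_normK ?num_real//; move: `|z| => y.
  rewrite -subr_ge0.
  have -> : beta%:R / (M + M) * y ^+ 2 + M / (beta%:R + beta%:R) - y =
      (beta%:R * y - M) ^+ 2 / ((M + M) * beta%:R).
    by field; rewrite !gt_eqF ?addr_gt0.
  by rewrite divr_ge0 ?sqr_ge0 ?mulr_ge0 ?addr_ge0 ?ltW.
apply: (le_trans (Ex_le _ _ _ _ (fun y => amgm _))).
(* Each of the two terms contributes [M / (2 * beta)], since [B = beta * beta]. *)
rewrite ExDc ExZ; apply: le_trans (lerD (ler_wpM2l _ sq) (lexx _)) _.
  by rewrite divr_ge0 ?addr_ge0 ?ltW.
by rewrite BE natrM le_eqVlt; apply/orP; left; apply/eqP; field; rewrite !gt_eqF ?addr_gt0.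
Qed.

End Counters.

(** * Inner products of bucketed vectors *)

Lemma l1norm_insdel n (s : seq ('I_n * int)) :
  l1norm (fun i => insv s i + delv s i) = \sum_(u <- s) `|u.2|.
Proof.
rewrite /l1norm (partition_big (fun u : 'I_n * int => u.1) xpredT)//=.
apply: eq_bigr => i _; rewrite (bigID (fun u : 'I_n * int => 0 <= u.2))/=.
rewrite ger0_norm; last first.
  by rewrite addr_ge0 ?normr_ge0// sumr_ge0// => u /andP[].
congr (_ + _); first by apply: eq_bigr => u /andP[_ /ger0_norm].
rewrite [RHS](eq_bigl (fun u : 'I_n * int => (u.1 == i) && (u.2 < 0))); last first.
  by move=> u; rewrite ltNge.
rewrite /delv -normrN -sumrN ger0_norm; last first.
  by rewrite sumr_ge0// => u /andP[_ /ltW]; rewrite oppr_ge0.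
by apply: eq_bigr => u /andP[_ /ltr0_norm].
Qed.

(** * The exact counts that the counters approximate *)

Section Mass.
Variables (n k : nat) (T : finType) (h : T -> 'I_n -> 'I_k).
Implicit Types (s : seq (tupdate n)) (t : T).

(** Each update of stream [e] feeds exactly one of these counters, and [|I + D|_1] is the sum of the
    absolute updates; the total is thus the same for every seed. *)
Lemma mass_total t e s :
  (\sum_b \sum_sg mass h t (e, b, sg) s)%:Z =
  l1norm (fun i => insv (substream e s) i + delv (substream e s) i).
Proof.
rewrite l1norm_insdel big_map big_filter.
rewrite pair_bigA /= (partition_big
  (fun u : tupdate n => (h t u.1.2, u.2 < 0)) xpredT)//=.
rewrite (big_morph Posz PoszD (erefl _)).
apply: eq_bigr => -[b sg] _; rewrite /mass (big_morph Posz PoszD (erefl _)).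
by apply: eq_big => [u|//]; rewrite /slot !xpair_eqE andbA.
Qed.

Lemma mass_le t j m M s : (size (substream j.1.1 s) <= m)%N ->
  all (fun u : tupdate n => `|u.2| <= M%:Z) s -> (mass h t j s <= m * M)%N.
Proof.
rewrite /substream size_map size_filter => sm /allP sM.
apply: leq_trans (leq_mul sm (leqnn M)).
rewrite -sum1_count big_distrl /= /mass.
rewrite [leqLHS](bigID (fun u : tupdate n => u.1.1 == j.1.1)) /=.
rewrite [X in (_ + X)%N]big1 ?addn0 => [|u /andP[/eqP<- /=]]; last by rewrite eqxx.
rewrite big_mkcond [leqRHS]big_mkcond [leqLHS]big_seq [leqRHS]big_seq.
apply: leq_sum => u /sM uM; case: ifP => [/andP[_ ->]|_//].
by rewrite mul1n -lez_nat abszE.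
Qed.

Lemma mass_net (R : realType) t e b s :
  (mass h t (e, b, false) s)%:R - (mass h t (e, b, true) s)%:R =
  \sum_(i | h t i == b) (freq (substream e s) i)%:~R :> R.
Proof.
rewrite !pmulrn -intrB -rmorph_sum /=; congr _%:~R.
transitivity (\sum_(u <- s | (u.1.1 == e) && (h t u.1.2 == b)) u.2).
  rewrite [RHS](bigID (fun u : tupdate n => u.2 < 0))/= addrC.
  rewrite /mass !(big_morph Posz PoszD (erefl _)) -sumrN; congr (_ + _).
    apply: eq_big => [u|u /andP[_ /eqP]]; rewrite /slot ?xpair_eqE.
      by case: (u.2 < 0).
    by move=> /negbT; rewrite -leNgt abszE => /ger0_norm.
  apply: eq_big => [u|u /andP[_ /eqP]]; rewrite /slot ?xpair_eqE.
    by case: (u.2 < 0).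
  by rewrite abszE => /ltr0_norm ->; rewrite opprK.
rewrite (partition_big (fun u : tupdate n => u.1.2) (fun i => h t i == b)) /=.
  apply: eq_bigr => i /eqP hi; rewrite /freq big_map big_filter_cond /=.
  by apply: eq_bigl => u; case: (u.1.2 =P i) => [->|]; rewrite ?hi ?eqxx ?andbT ?andbF.
by move=> u /andP[].
Qed.

End Mass.

Section Deterministic.
Variables (R : realFieldType) (n k : nat) (f g : 'I_n -> R) (h : 'I_n -> 'I_k).

Definition bucket (v : 'I_n -> R) (b : 'I_k) : R := \sum_(i | h i == b) v i.

Definition collision : R :=
  \sum_i \sum_(j | (i != j) && (h i == h j)) `|f i| * `|g j|.

Lemma bucket_l1 v : \sum_b `|bucket v b| <= \sum_i `|v i|.
Proof.
rewrite [leRHS](partition_big h xpredT)//=; apply: ler_sum => b _.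
exact: ler_norm_sum.
Qed.

(** In the expanded product the terms [i = j] give the exact inner product; the others come from
    distinct colliding coordinates. *)
Lemma bucket_inner :
  `|\sum_b bucket f b * bucket g b - \sum_i f i * g i| <= collision.
Proof.
have -> : \sum_b bucket f b * bucket g b =
    \sum_i \sum_(j | h i == h j) f i * g j.
  rewrite [RHS](partition_big h xpredT)//=; apply: eq_bigr => b _.
  rewrite mulr_suml; apply: eq_bigr => i /eqP hi; rewrite mulr_sumr.
  by apply: eq_bigl => j; rewrite hi eq_sym.
rewrite -sumrB; apply: le_trans (ler_norm_sum _ _ _) _; apply: ler_sum => i _.
rewrite (bigD1 i)//= addrAC subrr add0r (eq_bigl (fun j => (i != j) && (h i == h j))).
  by apply: le_trans (ler_norm_sum _ _ _) _; apply: ler_sum => j _; rewrite normrM.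
by move=> j; rewrite andbC eq_sym.
Qed.

Lemma ler_sum_mul (I : finType) (x y : I -> R) :
  (forall i, 0 <= x i) -> (forall i, 0 <= y i) ->
  \sum_i x i * y i <= (\sum_i x i) * (\sum_i y i).
Proof.
move=> x0 y0; rewrite mulr_suml; apply: ler_sum => i _.
by rewrite ler_wpM2l// (bigD1 i)//= lerDl sumr_ge0.
Qed.

(** Two mixed terms and a product of errors arise. Each is at most a product of L1 norms, and
    bucketing does not increase the L1 norm. *)
Lemma perturbed_inner (p q : 'I_k -> R) (a d : R) :
  \sum_b `|p b - bucket f b| <= a -> \sum_b `|q b - bucket g b| <= d ->
  `|\sum_b p b * q b - \sum_i f i * g i| <=
  collision + (a * (\sum_i `|g i|) + (\sum_i `|f i|) * d + a * d).
Proof.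
move=> pa qd.
have -> : \sum_b p b * q b - \sum_i f i * g i =
    (\sum_b bucket f b * bucket g b - \sum_i f i * g i) +
    \sum_b ((p b - bucket f b) * bucket g b + bucket f b * (q b - bucket g b) +
       (p b - bucket f b) * (q b - bucket g b)).
  rewrite addrAC -big_split /=; congr (_ - _); apply: eq_bigr => b _; ring.
apply: le_trans (ler_normD _ _) (lerD bucket_inner _).
rewrite !big_split /=.
have le (x y : 'I_k -> R) : `|\sum_b x b * y b| <= (\sum_b `|x b|) * (\sum_b `|y b|).
  apply: le_trans (ler_norm_sum _ _ _) _.
  by under eq_bigr do rewrite normrM; apply: ler_sum_mul.
by apply: le_trans (ler_normD _ _) (lerD (le_trans (ler_normD _ _) (lerD _ _)) _);
  apply: le_trans (le _ _) _; rewrite ler_pM ?sumr_ge0 ?bucket_l1.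
Qed.

End Deterministic.

(** * A hash family with a short seed *)

(* Reed-Solomon code: distinct polynomials of size at most [d] agree on fewer
   than [d] points. *)
Lemma reed_solomon (F : finFieldType) (n d : nat) : (n <= #|F| ^ d)%N ->
  exists code : 'I_n -> F -> F, forall i j, i != j ->
    (#|[set x | code i x == code j x]| <= d)%N.
Proof.
move=> nd; have nd' : (n <= #|{: 'rV[F]_d}|)%N by rewrite card_mx mul1n.
pose p i := rVpoly (enum_val (widen_ord nd' i)).
exists (fun i x => (p i).[x]) => i j ij.
have pij : p i - p j != 0.
  rewrite subr_eq0; apply: contra ij => /eqP/(can_inj rVpolyK)/enum_val_inj.
  by move/(congr1 val) => /= ij; apply/eqP/val_inj.
have sz : (size (p i - p j)%R <= d)%N.
  by rewrite (leq_trans (size_polyD _ _))// size_polyN geq_max !size_poly.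
apply: leq_trans _ sz; rewrite cardE; apply/ltnW/max_poly_roots => //.
  apply/allP => x; rewrite mem_enum inE => /eqP pp.
  by rewrite /root hornerD hornerN pp subrr.
exact: enum_uniq.
Qed.

Section Affine.
Variables (R : realFieldType) (F : finFieldType) (k : nat).

Definition residue (y : F) : 'I_k.+1 := inord (enum_rank y %% k.+1).

(** A residue class has at most [#|F| %/ k.+1 + 1] elements; as [k.+1 <= #|F|], the extra one costs
    at most a factor 2. *)
Lemma card_residue (r : 'I_k.+1) : (k.+1 <= #|F|)%N ->
  (#|[set y | residue y == r]|%:R / #|F|%:R <= 2 / k.+1%:R :> R).
Proof.
move=> kF; have F0 : (0 < #|F|)%N by apply: leq_trans kF.
rewrite ler_pdivrMr ?ltr0n// mulrAC ler_pdivlMr ?ltr0n// -!natrM ler_nat.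
have c : (#|[set y | residue y == r]| <= (#|F| %/ k.+1).+1)%N.
  pose q (y : F) : 'I_(#|F| %/ k.+1).+1 := inord (enum_rank y %/ k.+1).
  rewrite -[X in (_ <= X)%N]card_ord -(card_in_imset (f := q)) ?max_card// => y z.
  rewrite !inE => /eqP <- /eqP/(congr1 val); rewrite /= !inordK ?ltn_pmod// => zy.
  have qlt (x : F) : (enum_rank x %/ k.+1 < (#|F| %/ k.+1).+1)%N.
    by rewrite ltnS leq_div2r ?(ltnW (ltn_ord _)).
  move/(congr1 val); rewrite /= !inordK// => yz.
  by apply: enum_rank_inj; apply: val_inj; rewrite /= (divn_eq (enum_rank y) k.+1) yz -zy -divn_eq.
apply: leq_trans (leq_mul c (leqnn _)) _.
rewrite mulSn mul2n -addnn addnC leq_add//; exact: leq_trunc_div.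
Qed.

(** For [y != z] the coefficients [(a, b)] correspond bijectively to the two images, which are
    therefore independent and uniform; with the first image fixed, the second must hit its residue
    class. *)
Lemma affine_collision (y z : F) : (k.+1 <= #|F|)%N -> y != z ->
  avg (fun ab : F * F =>
    (residue (ab.1 * y + ab.2) == residue (ab.1 * z + ab.2))%:R) <= 2 / k.+1%:R :> R.
Proof.
move=> kF yz; pose h (ab : F * F) := (ab.1 * y + ab.2, ab.1 * z + ab.2).
have hb : bijective h.
  apply: injF_bij => -[a b] [a' b'] [/= hy hz].
  have : (a - a') * (y - z) = 0.
    have -> : (a - a') * (y - z) = (a * y + b) - (a * z + b) -
        ((a' * y + b') - (a' * z + b')) by ring.
    by rewrite hy hz subrr.
  move/eqP; rewrite mulf_eq0 !subr_eq0 (negbTE yz) orbF => /eqP aa.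
  by move: hy; rewrite aa => /addrI ->.
rewrite -(reindex_avg (fun uv : F * F => (residue uv.1 == residue uv.2)%:R) hb) avg_pair.
rewrite -[leRHS](@avg_cst R F) ?(leq_trans _ kF)//; apply: ler_avg => u.
apply: le_trans (card_residue (residue u) kF).
rewrite /avg -sum1_card natr_sum [X in _ <= X / _]big_mkcond /= le_eqVlt.
apply/orP; left; apply/eqP; congr (_ / _); apply: eq_bigr => v _.
by rewrite inE eq_sym; case: (_ == _).
Qed.

End Affine.

(* A Reed-Solomon symbol is hashed into the buckets by a random affine map. The
   seed consists of three elements of a field with [2 ^ e] elements, where
   [e = O(log (d * k))]. *)
Lemma hash_family (R : realFieldType) (e n d k : nat) :
  (0 < e)%N -> (n <= 2 ^ d)%N -> (d * k.+1 <= 2 ^ e)%N -> (k.+1 <= 2 ^ e)%N ->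
  exists (T : finType) (h : T -> 'I_n -> 'I_k.+1), #|T| = (2 ^ (e * 3))%N /\
    (forall i j, i != j -> avg (fun t => (h t i == h t j)%:R : R) <= 3 / k.+1%:R).
Proof.
move=> e0 nd dk ke; have [F _ cF] := @pPrimePowerField 2 e isT e0.
have F0 : (0 < #|F|)%N by rewrite cF expn_gt0.
have nF : (n <= #|F| ^ d)%N.
  case: (d) nd => [//|d' /leq_trans]; apply; rewrite leq_exp2r// cF.
  by rewrite -[X in (X <= _)%N](expn1 2) leq_exp2l.
have [code codeP] := reed_solomon nF.
pose h (t : F * (F * F)) i := residue k (t.2.1 * code i t.1 + t.2.2).
exists (F * (F * F))%type, h; split=> [|i j ij].
  by rewrite !card_prod cF -!expnD; congr (2 ^ _)%N; lia.
rewrite avg_pair.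
(* The codewords agree at a random position with probability at most [d / #|F| <= 1 / k.+1]; where
   they differ, the affine map collides with probability at most [2 / k.+1]. *)
have le x : avg (fun ab : F * F => (h (x, ab) i == h (x, ab) j)%:R) <=
    (code i x == code j x)%:R + 2 / k.+1%:R :> R.
  have [_|ne] := eqVneq (code i x) (code j x).
    rewrite -[leLHS]addr0 lerD ?divr_ge0 ?ler0n//.
    rewrite -[leRHS](@avg_cst R (F * F)%type 1) ?card_prod ?muln_gt0 ?F0//.
    by apply: ler_avg => ab; case: (_ == _); rewrite ?ler01.
  have kF : (k.+1 <= #|F|)%N by rewrite cF.
  by rewrite -[leLHS]add0r lerD ?ler0n//; exact: (affine_collision R kF ne).
apply: le_trans (ler_avg le) _; rewrite avgD avg_cst//.
have -> : 3 / k.+1%:R = 1 / k.+1%:R + 2 / k.+1%:R :> R by rewrite -mulrDl; congr (_ / _); ring.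
rewrite lerD2r ler_pdivlMr ?ltr0n// /avg mulrAC ler_pdivrMr ?ltr0n// mul1r.
have -> : \sum_x (code i x == code j x)%:R = #|[set x | code i x == code j x]|%:R :> R.
  rewrite -sum1_card natr_sum [RHS]big_mkcond /=; apply: eq_bigr => x _.
  by rewrite inE; case: (_ == _).
rewrite -natrM ler_nat (leq_trans _ (leq_trans dk _)) ?cF//.
by rewrite leq_mul2r codeP ?orbT.
Qed.

(** * The sketch *)

Section Sketch.
Variables (R : realType) (n k B V K S : nat) (T : finType) (t0 : T).
Variable h : T -> 'I_n -> 'I_k.
Hypothesis K0 : (0 < K)%N.
Hypothesis TK : (#|T| %| K)%N.
Hypothesis cardS : #|{: cstate k V T}| = (2 ^ S)%N.

Definition encode (x : cstate k V T) : 'I_(2 ^ S) := cast_ord cardS (enum_rank x).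

Definition decode (i : 'I_(2 ^ S)) : cstate k V T := enum_val (cast_ord (esym cardS) i).

Lemma encodeK : cancel encode decode.
Proof. by move=> x; rewrite /decode /encode cast_ordK enum_rankK. Qed.

Definition estimate (x : cstate k V T) (e : bool) (b : 'I_k) : R :=
  (grid B (x.2 (e, b, false)))%:R - (grid B (x.2 (e, b, true)))%:R.

(** The seed is drawn with the initial coin and kept in the state, since it is reused at every
    update; all counters start at 0. *)
Definition sketch : stream_alg n S R :=
  @StreamAlg n S R K
    (fun c => encode (nth t0 (enum T) (c %% #|T|), [ffun=> ord0]))
    (fun i u c => encode (cstep B h (decode i) u c))
    (fun i => \sum_b estimate (decode i) false b * estimate (decode i) true b).

Lemma sketch_law (phi : cstate k V T -> R) s :
  avg (fun c => phi (decode (@sa_final _ _ _ sketch s c))) =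
  avg (fun t => Ex (cstep B h (K := K)) phi s (t, [ffun=> ord0])).
Proof.
rewrite (avg_sa_exec (A := sketch) (fun i => phi (decode i)) s (@sa_init _ _ _ sketch)) /=.
rewrite -[RHS](avg_modn_enum t0 _ K0 TK); apply: eq_avg => c.
rewrite (Ex_sim (step' := cstep B h (K := K)) (h := encode)); last first.
  by move=> x u c'; rewrite encodeK.
elim: s (nth _ _ _, _) => [|u s IH] x /=; first by rewrite encodeK.
by apply: eq_avg => c'; apply: IH.
Qed.

Hypothesis B0 : (0 < B)%N.
Hypothesis gapK : forall j, (j < V)%N -> ((grid B j %/ B).+1 %| K)%N.
Variables (beta : nat) (alpha : R).
Hypothesis BE : B = (beta * beta)%N.
Variables (s : seq (tupdate n)) (m M : nat).
Hypothesis mMV : (m * M <= grid B V)%N.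
Hypothesis sM : all (fun u : tupdate n => `|u.2| <= M%:Z) s.

Let Omega := {ffun 'I_(size s).+1 -> 'I_K}.
Let final (c : Omega) := decode (@sa_final _ _ _ sketch s c).
Let v e i : R := (freq (substream e s) i)%:~R.

Definition counter_error (e : bool) (x : cstate k V T) : R :=
  \sum_b \sum_sg `|(grid B (x.2 (e, b, sg)))%:R - (mass h x.1 (e, b, sg) s)%:R|.

Lemma T_gt0 : (0 < #|T|)%N.
Proof. by apply/card_gt0P; exists t0. Qed.

(** For each fixed seed the expected errors add up to at most [|I + D|_1 / beta], to which the
    alpha-property applies. *)
Lemma avg_counter_error e :
  (size (substream e s) <= m)%N -> alpha_property alpha (substream e s) ->
  avg (fun c => counter_error e (final c)) <= alpha / beta%:R * (\sum_i `|v e i|).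
Proof.
move=> sm ap; rewrite /counter_error.
under eq_avg do rewrite pair_bigA.
rewrite avg_sum.
apply: (@le_trans _ _ (\sum_(p : 'I_k * bool)
    avg (fun t => (mass h t (e, p.1, p.2) s)%:R / beta%:R))).
  apply: ler_sum => -[b sg] _ /=.
  rewrite (sketch_law (fun x => `|(grid B (x.2 (e, b, sg)))%:R -
    (mass h x.1 (e, b, sg) s)%:R|)).
  apply: ler_avg => t; rewrite Ex_invariant//=.
  apply: Ex_counter_abs => //; first by rewrite ffunE.
  by apply: leq_trans mMV; apply: mass_le.
rewrite -avg_sum -[leRHS](@avg_cst R T) ?T_gt0//; apply: ler_avg => t.
rewrite -mulr_suml mulrAC ler_wpM2r ?invr_ge0 ?ler0n// -natr_sum.
have := ap; rewrite /alpha_property -(mass_total h t) pair_bigA /= => /le_trans; apply.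
rewrite /l1norm rmorph_sum /= le_eqVlt; apply/orP; left; apply/eqP; congr (_ * _).
by apply: eq_bigr => i _; rewrite /v intr_norm.
Qed.

Lemma estimate_error e x :
  \sum_b `|estimate x e b - bucket (h x.1) (v e) b| <= counter_error e x.
Proof.
have tri (X Y X' Y' : R) : `|X - Y - (X' - Y')| <= `|X - X'| + `|Y - Y'|.
  have -> : X - Y - (X' - Y') = (X - X') + (Y' - Y) by ring.
  by rewrite (le_trans (ler_normD _ _))// lerD2l distrC.
apply: ler_sum => b _; rewrite big_bool [leRHS]addrC /bucket /v -mass_net.
exact: tri.
Qed.

(** Updates leave the seed alone, so the final seed is uniform, and linearity reduces the mean to
    pairwise collision probabilities. *)
Lemma avg_collision (kappa : R) : 0 <= kappa ->
  (forall i j, i != j -> avg (fun t => (h t i == h t j)%:R : R) <= kappa) ->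
  avg (fun c => collision (v false) (v true) (h (final c).1)) <=
  kappa * (\sum_i `|v false i|) * (\sum_i `|v true i|).
Proof.
move=> k0 hk; rewrite (sketch_law (fun x => collision (v false) (v true) (h x.1))).
have -> : avg (fun t => Ex (cstep B h (K := K))
      (fun x : cstate k V T => collision (v false) (v true) (h x.1)) s (t, [ffun=> ord0])) =
    avg (fun t => \sum_i \sum_(j | i != j) `|v false i| * `|v true j| *
      (h t i == h t j)%:R).
  apply: eq_avg => t; rewrite Ex_invariant//= Ex_cst//.
  apply: eq_bigr => i _; rewrite big_mkcondr; apply: eq_bigr => j _.
  by case: (_ == _); rewrite ?mulr1 ?mulr0.
rewrite avg_sum -mulrA mulr_suml mulr_sumr; apply: ler_sum => i _.
under eq_avg do rewrite big_mkcond.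
rewrite avg_sum !mulr_sumr; apply: ler_sum => j _; case: (boolP (i != j)) => [ij|_].
  by rewrite avgZ mulrC ler_wpM2r ?mulr_ge0// hk.
by rewrite (_ : avg _ = 0) ?mulr_ge0// /avg big1// mul0r.
Qed.

(** Markov's inequality with factor 20, for the collision error and the counter errors of both
    streams, leaves probability [1 - 3 / 20]. The constants are [20 * kappa], twice [20 * theta] for
    the mixed terms, and [(20 * theta) ^+ 2] for the product of errors. *)
Lemma sketch_correct (kappa theta : R) : theta = alpha / beta%:R -> 0 <= kappa -> 0 <= alpha ->
  (forall i j, i != j -> avg (fun t => (h t i == h t j)%:R : R) <= kappa) ->
  (forall e, (size (substream e s) <= m)%N) ->
  (forall e, alpha_property alpha (substream e s)) ->
  17 / 20 <= sa_prob sketch s (fun x =>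
    `|x - (inner (freq (substream false s)) (freq (substream true s)))%:~R| <=
    (20 * kappa + 40 * theta + 400 * theta ^+ 2) *
    (l1norm (freq (substream false s)))%:~R * (l1norm (freq (substream true s)))%:~R).
Proof.
move=> thE k0 a0 hk sm ap.
have l1E e : (l1norm (freq (substream e s)))%:~R = \sum_i `|v e i| :> R.
  by rewrite /l1norm rmorph_sum; apply: eq_bigr => i _; rewrite /= intr_norm.
have innerE : (inner (freq (substream false s)) (freq (substream true s)))%:~R =
    \sum_i v false i * v true i :> R.
  by rewrite /inner rmorph_sum; apply: eq_bigr => i _; rewrite /= intrM.
rewrite sa_probE !l1E innerE.
set F := \sum_i `|v false i|; set G := \sum_i `|v true i|.
have F0 : 0 <= F by apply: sumr_ge0.
have G0 : 0 <= G by apply: sumr_ge0.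
have th0 : 0 <= theta by rewrite thE divr_ge0.
pose C c := collision (v false) (v true) (h (final c).1).
pose E e c := counter_error e (final c).
have C0 c : 0 <= C c by apply: sumr_ge0 => i _; apply: sumr_ge0 => j _; rewrite mulr_ge0.
have E0 e c : 0 <= E e c by apply: sumr_ge0 => b _; apply: sumr_ge0.
have t20 : 0 < 20 :> R by [].
have mC := markov C0 t20 (avg_collision k0 hk).
have mF := markov (E0 false) t20 (avg_counter_error (sm false) (ap false)).
have mG := markov (E0 true) t20 (avg_counter_error (sm true) (ap true)).
rewrite -thE -/F -/G in mC mF mG.
(* Union bound, pointwise: outside the three bad events the estimate is good, so the four indicators
   always sum to at least 1. *)
set P := fun c => _; have : 1 <= avg (fun c => P c + ((20 * (kappa * F * G) < C c)%R%:R +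
    ((20 * (theta * F) < E false c)%R%:R + (20 * (theta * G) < E true c)%R%:R))).
  rewrite -[leLHS](@avg_cst R Omega) ?card_ffun ?card_ord ?expn_gt0 ?K0//.
  apply: ler_avg => c.
  have nn (b : bool) : 0 <= b%:R :> R by rewrite ler0n.
  case: (ltP (20 * (kappa * F * G)) (C c)) => [_|cC].
    by rewrite addrCA lerDl !addr_ge0 ?nn.
  case: (ltP (20 * (theta * F)) (E false c)) => [_|cF].
    by rewrite add0r addrCA lerDl !addr_ge0 ?nn.
  case: (ltP (20 * (theta * G)) (E true c)) => [_|cG].
    by rewrite !add0r lerDr ?nn.
  have pF := le_trans (estimate_error false (final c)) cF.
  have pG := le_trans (estimate_error true (final c)) cG.
  have le : `|\sum_b estimate (final c) false b * estimate (final c) true b -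
      \sum_i v false i * v true i| <=
      (20 * kappa + 40 * theta + 400 * theta ^+ 2) * F * G; last first.
    by rewrite (_ : P c = true%:R) ?lerDl ?addr_ge0 ?nn//; congr (nat_of_bool _)%:R.
  apply: le_trans (perturbed_inner pF pG) _; rewrite -/F -/G -/(C c).
  apply: le_trans (lerD cC (lexx _)) _; rewrite le_eqVlt; apply/orP; left.
  by apply/eqP; ring.
rewrite !avgD; lra.
Qed.

End Sketch.

(** * Choice of parameters *)

(** The seed takes [e * 3] bits, and each of the [2 * k.+1 * 2] counters takes [e] bits. *)
Lemma sketch_exists (R : realType) (n m M c d k e beta : nat) (alpha theta : R) :
  (n <= 2 ^ d)%N -> (m * M <= n ^ c)%N -> (0 < e)%N -> (0 < beta)%N ->
  (d * k.+1 <= 2 ^ e)%N -> (k.+1 <= 2 ^ e)%N ->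
  (c * d * (beta * beta) + 2 <= 2 ^ e)%N ->
  0 <= alpha -> theta = alpha / beta%:R ->
  exists A : stream_alg n (e * 3 + e * (2 * k.+1 * 2)) R,
    forall s : seq (tupdate n),
      all (fun u : tupdate n => `|u.2| <= M%:Z) s ->
      (forall b, (size (substream b s) <= m)%N) ->
      (forall b, alpha_property alpha (substream b s)) ->
      17 / 20 <= sa_prob A s (fun x =>
        `|x - (inner (freq (substream false s)) (freq (substream true s)))%:~R| <=
        (20 * (3 / k.+1%:R) + 40 * theta + 400 * theta ^+ 2) *
        (l1norm (freq (substream false s)))%:~R *
        (l1norm (freq (substream true s)))%:~R).
Proof.
move=> nd mM e0 b0 dk ke Be a0 thE.
have [T [h [cT hk]]] := hash_family R e0 nd dk ke.
have T0 : (0 < #|T|)%N by rewrite cT expn_gt0.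
have [t0 _] : exists t0 : T, t0 \in T by apply/card_gt0P.
set B := (beta * beta)%N in Be.
have B0 : (0 < B)%N by rewrite muln_gt0 b0.
set V := (2 ^ e).-1; have VE : V.+1 = (2 ^ e)%N by rewrite prednK ?expn_gt0.
(* A common multiple of the number of seeds and of all grid gaps makes every required probability
   exact. *)
pose K := (#|T| * \prod_(j < V) (grid B j %/ B).+1)%N.
have K0 : (0 < K)%N by rewrite muln_gt0 T0 prodn_gt0.
have gapK j : (j < V)%N -> ((grid B j %/ B).+1 %| K)%N.
  by move=> jV; rewrite dvdn_mull// (bigD1 (Ordinal jV))//= dvdn_mulr.
have cS : #|{: cstate k.+1 V T}| = (2 ^ (e * 3 + e * (2 * k.+1 * 2)))%N.
  by rewrite card_prod cT card_ffun !card_prod !card_ord card_bool VE -expnM -expnD.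
have mMV : (m * M <= grid B V)%N.
  (* [n ^ c <= 2 ^ (c * d)] is reached from [grid B 1 = 1] by [c * d] doublings of [B] steps each;
     the [+ 2] in the hypothesis accounts for the first step and for the index 0. *)
  apply: leq_trans mM _; apply: (@leq_trans (2 ^ (c * d))).
    by rewrite mulnC expnM; case: (c) => // c'; rewrite leq_exp2r.
  apply: leq_trans (grid_exp _ B0) _; apply: grid_le.
  by rewrite -ltnS VE (leq_trans _ Be)// addn2.
exists (@sketch R n k.+1 B V K _ T t0 h cS) => s sM sm ap.
apply: sketch_correct thE _ a0 hk sm ap => //.
- exact: dvdn_mulr.
- exact: mMV.
- exact: sM.
- by rewrite divr_ge0.
Qed.

Section Log2.
Variable R : realType.

Let ln2_gt0 : 0 < ln 2 :> R.
Proof. by rewrite ln_gt0// ltr1n. Qed.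

Lemma log2M (x y : R) : 0 < x -> 0 < y -> log2 (x * y) = log2 x + log2 y.
Proof. by move=> x0 y0; rewrite /log2 lnM// mulrDl. Qed.

Lemma ler_log2 (x y : R) : 0 < x -> x <= y -> log2 x <= log2 y.
Proof.
move=> x0 xy; rewrite /log2 ler_wpM2r ?invr_ge0 ?(ltW ln2_gt0)// ler_ln// posrE//.
exact: lt_le_trans xy.
Qed.

Lemma log2_2 : log2 2 = 1 :> R.
Proof. by rewrite /log2 divff// gt_eqF. Qed.

Lemma log2_ge1 (x : R) : 2 <= x -> 1 <= log2 x.
Proof. by move=> x2; rewrite -log2_2 ler_log2. Qed.

Lemma log2_ge0 (x : R) : 1 <= x -> 0 <= log2 x.
Proof. by move=> x1; apply: divr_ge0; [exact: ln_ge0 | exact: ltW]. Qed.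

Lemma log2X (n : nat) : log2 (2 ^+ n) = n%:R :> R.
Proof. by rewrite /log2 lnXn// -(mulr_natl (ln _)) mulfK// gt_eqF. Qed.

Lemma up_log_le (n : nat) : (1 < n)%N -> (up_log 2 n)%:R <= log2 n%:R + 1 :> R.
Proof.
move=> n1; have := @up_log_gtn 2 n isT n1.
have : (0 < up_log 2 n)%N by rewrite up_log_gt0.
case: (up_log 2 n) => // u _ /= un; rewrite -addn1 natrD lerD2r -log2X.
by rewrite ler_log2 ?exprn_gt0// -natrX ler_nat ltnW.
Qed.

Lemma truncnS_bounds (x : R) : 1 <= x ->
  x <= (Num.truncn x).+1%:R /\ (Num.truncn x).+1%:R <= x + 1.
Proof.
move=> x1; have /andP[lo hi] := truncn_itv (le_trans ler01 x1).
by rewrite ltW// -addn1 natrD lerD2r lo.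
Qed.

End Log2.

Lemma inner_le n (f g : 'I_n -> int) : `|inner f g| <= l1norm f * l1norm g.
Proof.
apply: le_trans (ler_norm_sum _ _ _) _; rewrite /l1norm mulr_suml.
apply: ler_sum => i _; rewrite normrM ler_wpM2l// (bigD1 i)//= lerDl.
by rewrite sumr_ge0.
Qed.

Lemma l1norm_ge0 n (f : 'I_n -> int) : 0 <= l1norm f.
Proof. by apply: sumr_ge0. Qed.

(** The constant estimate 0 suffices, because [|<f,g>| <= |f|_1 |g|_1]. *)
Lemma zero_sketch (R : realType) (n : nat) (a : R) : 1 <= a ->
  exists A : stream_alg n 0 R, forall s : seq (tupdate n),
    sa_prob A s (fun x =>
      `|x - (inner (freq (substream false s)) (freq (substream true s)))%:~R| <=
      a * (l1norm (freq (substream false s)))%:~R *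
      (l1norm (freq (substream true s)))%:~R) = 1.
Proof.
move=> a1; exists (@StreamAlg n 0 R 1 (fun=> ord0) (fun _ _ _ => ord0) (fun=> 0)) => s.
rewrite sa_probE (eq_avg (g := fun=> 1)) => [|c /=].
  by rewrite avg_cst// card_ffun card_ord exp1n.
rewrite sub0r normrN -intr_norm -mulrA -intrM.
have F0 := l1norm_ge0 (freq (substream false s)).
have G0 := l1norm_ge0 (freq (substream true s)).
rewrite (le_trans (y := (l1norm (freq (substream false s)) *
  l1norm (freq (substream true s)))%:~R))//.
  by rewrite ler_int inner_le.
by rewrite ler_peMl// ler0z mulr_ge0.
Qed.

(** The argument of [up_log] is at most [(8 * c + 8) * Q ^+ 3] with [Q = alpha * log2 n / eps]. From
    [eps < 1 / 2] follows [Q >= 2], so [log2 Q >= 1] absorbs the additive constants. *)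
Lemma sketch_parameters (R : realType) (c n d k beta e : nat) (eps alpha : R) :
  (2 <= n)%N -> 0 < eps < 2^-1 -> 1 <= alpha ->
  d = up_log 2 n -> k = Num.truncn eps^-1 -> beta = (Num.truncn (alpha / eps)).+1 ->
  e = up_log 2 (d * k.+1 + c * d * (beta * beta) + 2) ->
  (e * 3 + e * (2 * k.+1 * 2))%:R <=
  8 * (4 + log2 (8 * c + 8)%:R) * (eps^-1 * log2 (alpha * log2 n%:R / eps)) :> R.
Proof.
move=> n2 /andP[eps0 eps2] alpha1 dE kE bE eE.
have lam1 : 1 <= log2 n%:R :> R by apply: log2_ge1; rewrite ler_nat.
have dle : d%:R <= log2 n%:R + 1 :> R by rewrite dE up_log_le.
have v2 : 2 <= eps^-1 by rewrite -[2]invrK lef_pV2 ?posrE ?invr_gt0//; apply: ltW.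
have kle : k.+1%:R <= eps^-1 + 1 :> R.
  by rewrite kE; apply: (truncnS_bounds _).2; lra.
have [w wE] : exists w, w = alpha / eps by exists (alpha / eps).
rewrite -wE in bE.
move: (eps^-1) (log2 n%:R) v2 lam1 dle kle wE => v lam v2 lam1 dle kle wE.
have w2 : 2 <= w by rewrite wE; nra.
have ble : beta%:R <= 2 * w.
  have w1 : 1 <= w by lra.
  by rewrite bE; have := (truncnS_bounds w1).2; lra.
have [Q QE] : exists Q, Q = alpha * lam * v by exists (alpha * lam * v).
rewrite -QE; set l := log2 Q; set L := log2 _.
have wQ : w <= Q.
  by rewrite wE QE mulrAC ler_peMr// mulr_ge0; lra.
have lvQ : lam * v <= Q.
  by rewrite QE -mulrA ler_peMl// mulr_ge0; lra.
have Q2 : 2 <= Q by lra.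
have l1 : 1 <= l by apply: log2_ge1.
have L0 : 0 <= L by apply: log2_ge0; rewrite ler1n addn_gt0 orbT.
have Q3 : Q <= Q ^+ 3 by rewrite ler_eXnr//; lra.
have dkle : d%:R * k.+1%:R <= 4 * Q ^+ 3.
  have : d%:R * k.+1%:R <= (2 * lam) * (2 * v) by apply: ler_pM; rewrite ?ler0n//; lra.
  lra.
have cdb : c%:R * d%:R * (beta%:R * beta%:R) <= c%:R * (8 * Q ^+ 3).
  rewrite -mulrA ler_wpM2l//.
  have : d%:R * (beta%:R * beta%:R) <= (2 * lam) * (2 * w * (2 * w)).
    by apply: ler_pM; rewrite ?mulr_ge0 ?ler0n ?ler_pM ?ler0n//; lra.
  have -> : 2 * lam * (2 * w * (2 * w)) = 8 * (Q * w) by rewrite wE QE; ring.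
  have : Q * w <= Q ^+ 3 by rewrite exprS ler_wpM2l ?(le_trans wQ)//; nra.
  lra.
have eL : e%:R <= (4 + L) * l.
  have : e%:R <= log2 (d * k.+1 + c * d * (beta * beta) + 2)%:R + 1 :> R.
    by rewrite eE up_log_le// addn2.
  have : log2 (d * k.+1 + c * d * (beta * beta) + 2)%:R <= log2 ((8 * c + 8)%:R * Q ^+ 3).
    apply: ler_log2; first by rewrite ltr0n addn2.
    rewrite !natrD !natrM; lra.
  rewrite log2M ?ltr0n ?addn_gt0 ?orbT ?exprn_gt0//; last by lra.
  rewrite !exprS expr0 mulr1 !log2M ?mulr_gt0 -/l -/L; [|lra..].
  nra.
have e0 : 0 <= e%:R :> R by rewrite ler0n.
rewrite natrD !natrM -mulrDr.
(* [3 + 4 * k.+1 <= 4 * v + 7 <= 8 * v], because [v >= 2]. *)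
have : e%:R * (3 + 2 * k.+1%:R * 2) <= (4 + L) * l * (8 * v).
  by apply: ler_pM; rewrite ?addr_ge0 ?mulr_ge0 ?ler0n//; lra.
nra.
Qed.

Unset Implicit Arguments.

(* The standing assumption log(mM) = O(log n) is rendered as m * M <= n ^ c
   for an arbitrary fixed constant c; the hidden constant C may depend on c. *)
Theorem theorem2p11 (R : realType) (c : nat) :
  exists C : R, 0 < C /\
  forall (n m M : nat) (eps alpha : R),
    (2 <= n)%N -> (m * M <= n ^ c)%N -> 0 < eps < 1 -> 1 <= alpha ->
    exists (S : nat) (A : stream_alg n S R),
      S%:R <= C * (eps^-1 * log2 (alpha * log2 (n%:R : R) / eps) + 1) /\
      forall s : seq (tupdate n),
        all (fun u : tupdate n => (`|u.2| <= M%:Z)) s ->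
        (size (substream false s) <= m)%N ->
        (size (substream true s) <= m)%N ->
        alpha_property alpha (substream false s) ->
        alpha_property alpha (substream true s) ->
        let f := freq (substream false s) in
        let g := freq (substream true s) in
        11 / 13 <= @sa_prob _ _ _ A s
          (fun x => `|x - (inner f g)%:~R| <=
                    C * eps * (l1norm f)%:~R * (l1norm g)%:~R).
Proof.
set L : R := log2 (8 * c + 8)%:R.
have L0 : 0 <= L by apply: log2_ge0; rewrite ler1n addn_gt0 orbT.
(* [500 = 60 + 40 + 400] covers the collision, mixed and product errors; the rest is the constant of
   the space bound. *)
exists (500 + 8 * (4 + L)); split; first by lra.
move=> n m M eps alpha n2 mM /andP[eps0 eps1] alpha1.
have v1 : 1 < eps^-1 by rewrite -[1]invr1 ltf_pV2 ?posrE.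
have lam1 : 1 <= log2 n%:R :> R by apply: log2_ge1; rewrite ler_nat.
have l0 : 0 <= log2 (alpha * log2 n%:R / eps).
  by apply: log2_ge0; apply: mulr_ege1 (ltW v1); apply: mulr_ege1.
have vl0 : 0 <= eps^-1 * log2 (alpha * log2 n%:R / eps) by rewrite mulr_ge0//; lra.
(* For [eps >= 1 / 2] the logarithm may come close to 0, but the allowed error is then at least
   [|f|_1 |g|_1]. *)
have [eps2|eps2] := ltP eps 2^-1; last first.
  have a1 : 1 <= (500 + 8 * (4 + L)) * eps by nra.
  have [A AP] := zero_sketch n a1.
  exists 0%N, A; split; first by rewrite mulr_ge0//; lra.
  by move=> s _ _ _ _ _; lazy zeta; rewrite AP; lra.
have eps02 : 0 < eps < 2^-1 by rewrite eps0.
have Sle := sketch_parameters (c := c) n2 eps02 alpha1 (erefl _) (erefl _) (erefl _) (erefl _).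
move: Sle; set d := up_log 2 n; set k := Num.truncn _; set beta := (Num.truncn _).+1.
set N := (_ + 2)%N; set e := up_log 2 N => Sle.
have Ne : (N <= 2 ^ e)%N by apply: up_logP.
have d0 : (0 < d)%N by rewrite up_log_gt0.
have dk : (d * k.+1 <= 2 ^ e)%N by rewrite (leq_trans _ Ne)// /N -addnA leq_addr.
have e0 : (0 < e)%N by rewrite up_log_gt0 /N addn2.
have ke : (k.+1 <= 2 ^ e)%N by apply: leq_trans dk; rewrite leq_pmull.
have Be : (c * d * (beta * beta) + 2 <= 2 ^ e)%N.
  by apply: leq_trans Ne; rewrite /N -addnA leq_addl.
have [A AP] := sketch_exists (up_logP n (isT : (1 < 2)%N)) mM e0 (ltn0Sn _ : (0 < beta)%N) dk ke Be
  (le_trans ler01 alpha1) (erefl (alpha / beta%:R)).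
exists _, A; split.
  apply: le_trans Sle _; rewrite -/L; nra.
have v0 : 0 < k.+1%:R :> R by rewrite ltr0n.
have vk : 3 / k.+1%:R <= 3 * eps.
  rewrite ler_wpM2l// -[eps]invrK lef_pV2 ?posrE ?invr_gt0//.
  by have [] := truncnS_bounds (ltW v1).
(* [beta] is the floor of [alpha / eps] plus one, hence at least [alpha / eps]. *)
have the : alpha / beta%:R <= eps.
  rewrite ler_pdivrMr ?ltr0n// mulrC -ler_pdivrMr//.
  by have [] := truncnS_bounds (mulr_ege1 alpha1 (ltW v1)).
have th0 : 0 <= alpha / beta%:R by rewrite divr_ge0//; lra.
move=> s sM sf sg af ag; lazy zeta.
(* [17 / 20] exceeds [11 / 13] by just [1 / 260]. *)
apply: (@le_trans _ _ (17 / 20)); first lra.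
apply: le_trans (AP s sM _ _) _; [by case|by case|].
rewrite !sa_probE; apply: ler_avg => x.
have bool_le (b1 b2 : bool) : (b1 -> b2) -> b1%:R <= b2%:R :> R.
  by case: b1 b2 => [] [] // /(_ isT).
apply: bool_le => /le_trans; apply.
rewrite !ler_wpM2r ?ler0z ?l1norm_ge0//.
move: vk the th0; move: (alpha / _) (3 / _) => th ka vk the th0.
have : th ^+ 2 <= eps by rewrite expr2; nra.
nra.
Qed.
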